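(* There exist universal constants $c,d>0$ such that for all Young subgroups $H_1,H_2,H_3\subseteq S_n$ with $H_1\cap H_2=H_2\cap H_3=H_1\cap H_3=\{1\}$, $$\frac{|S_n|}{(|H_1||H_2||H_3|)^{2/3}}\ \ge\ e^{cn-d\sqrt{n}\log n}.$$
   Context: $S_n$ is the symmetric group on $[n]=\{1,\dots,n\}$; the constants $c,d$ do not depend on $n$ or on the subgroups. A Young subgroup of $S_n$ is specified by a set partition of $[n]$ and consists of the permutations that map each part of the partition to itself; it is isomorphic to $S_{n_1}\times\dots\times S_{n_k}$, where $n_1,\dots,n_k$ are the sizes of the parts, $\sum n_i=n$. $\log$ is the natural logarithm.
   Formalization: The claim is stated for n ≥ 2 only: at n = 1 all subgroups are trivial, so the left side is 1 while the right side is e^c > 1, and at n = 0 log n is undefined. *)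

(* Defs.v *)
From mathcomp Require Import all_boot all_fingroup.

Set Implicit Arguments.
Unset Strict Implicit.
Unset Printing Implicit Defensive.

Definition young (n : nat) (P : {set {set 'I_n}}) : {set 'S_n} :=
  [set s : 'S_n | [forall B in P, s @: B == B]].

Lemma young_group_set (n : nat) (P : {set {set 'I_n}}) : group_set (young P).
Proof.
apply/group_setP; split=> [|s t].
  rewrite inE; apply/forall_inP => B _; apply/eqP.
  by rewrite -[RHS]imset_id; apply: eq_imset => i; rewrite perm1.
rewrite !inE => /forall_inP sP /forall_inP tP; apply/forall_inP => B PB.
apply/eqP; rewrite -[RHS](eqP (tP B PB)) -{2}(eqP (sP B PB)) -imset_comp.
by apply: eq_imset => i; rewrite /= permM.
Qed.

Canonical young_group (n : nat) (P : {set {set 'I_n}}) : {group 'S_n} :=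
  Group (young_group_set P).

Definition is_young_subgroup (n : nat) (H : {group 'S_n}) : Prop :=
  exists2 P : {set {set 'I_n}}, partition P [set: 'I_n] & H :=: young P.

(* Main.v *)
(* Let b_i(x) be the size of the block of x in the i-th partition and
   a_i(x) = (b_i(x)!)^(1/b_i(x)), so that |H_i| = prod_x a_i(x).  With
   y = (a_1 a_2 a_3)^(2/3), AM-GM gives
   (|H_1| |H_2| |H_3|)^(2/3) = prod_x y(x) <= ((sum_x y(x)) / n)^n.
   Blocks of distinct partitions share at most one point, so each sum_x b_i b_j
   is at most n^2.  If all three blocks of x have size at least 6, then
   a_i <= b_i / 2 and AM-GM gives y <= (b_1 b_2 + b_2 b_3 + b_1 b_3) / 12;
   if some b_i is at most 5, y grows only like (b_j b_k)^(2/3), which is at most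
   b_j b_k / 10 plus a constant.  Hence the mean of y is at most
   (3/10) n + O(1), while n! >= (n/3)^n; since 3/10 < 1/3, this gives
   exponential growth. *)

Require Import Defs.
From mathcomp Require Import all_boot all_order all_fingroup all_algebra.
From mathcomp Require Import reals sequences exp.
From mathcomp Require Import ring lra.

Set Implicit Arguments.
Unset Strict Implicit.
Unset Printing Implicit Defensive.

Import Order.TTheory GRing.Theory Num.Theory.
Local Open Scope ring_scope.

(** * Elementary bounds on factorials *)

Lemma double_fact_le (b : nat) : (6 <= b)%N -> (2 ^ b * b`! <= b ^ b)%N.
Proof.
(* The base case [46080 <= 46656] is computed; the bound fails at 5, whence the threshold 6. *)
elim: b => // b IHb; rewrite leq_eqVlt => /predU1P[[<-] //|b6].
have {}IHb := IHb b6.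
(* The first two binomial terms of [(b + 1) ^ b] both equal [b ^ b]. *)
have bernoulli : (2 * b ^ b <= b.+1 ^ b)%N.
  case: b b6 {IHb} => // b _.
  rewrite -(addn1 b.+1) expnDn big_ord_recl big_ord_recl /=.
  by rewrite bin0 bin1 subn0 subn1 !exp1n !muln1 mul1n -expnS mul2n -addnn leq_add2l leq_addr.
rewrite factS !expnS mulnACA (mulnC 2) -mulnA leq_mul2l /=.
by apply: leq_trans bernoulli; rewrite leq_mul2l.
Qed.

(** Induction on [n]: the step needs [(1 + 1/n)^n <= e <= 3]. *)
Lemma expn_le_fact (R : realType) (n : nat) :
  (n%:R / 3%:R) ^+ n <= n`!%:R :> R.
Proof.
have expR1_le3 : expR 1 <= 3%:R :> R.
  (* From [exp(-1/6) >= 5/6] follows [e <= (6/5)^6 < 3]. *)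
  have := expR_ge1Dx (- 6%:R^-1 : R).
  rewrite expRN => e6; have e60 := expR_gt0 (6%:R^-1 : R).
  have {}e6 : expR (6%:R^-1 : R) <= 6%:R / 5%:R.
    have : 5%:R / 6%:R * expR (6%:R^-1 : R) <= 1.
      rewrite -[leRHS](mulVf (lt0r_neq0 e60)) ler_pM2r //; lra.
    by lra.
  have -> : (1 : R) = 6%:R * 6%:R^-1 by lra.
  rewrite expRM_natl.
  by apply: (le_trans (lerXn2r 6 _ _ e6)); rewrite ?nnegrE; lra.
rewrite expr_div_n ler_pdivrMr ?exprn_gt0 ?ltr0n //.
elim: n => [|n IHn]; first by rewrite !expr0 mulr1.
have succ_pow : n.+1%:R ^+ n <= 3%:R * n%:R ^+ n :> R.
  case: n {IHn} => [|n]; first by rewrite !expr0 mulr1 ler1n.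
  have n0 : (0 : R) < n.+1%:R by rewrite ltr0n.
  have : (1 + n.+1%:R^-1) ^+ n.+1 <= expR (n.+1%:R^-1) ^+ n.+1 :> R.
    by rewrite lerXn2r ?nnegrE ?expR_ge0 ?expR_ge1Dx ?addr_ge0 ?invr_ge0 ?ltW.
  rewrite -expRM_natl mulfV ?lt0r_neq0 // => /le_trans/(_ expR1_le3).
  rewrite -(ler_pM2r (exprn_gt0 n.+1 n0)) -exprMn mulrDl mul1r mulVf ?lt0r_neq0 //.
  by rewrite natr1.
rewrite factS natrM exprS [in leRHS]exprS -!mulrA ler_pM2l ?ltr0n //.
rewrite mulrCA (le_trans succ_pow) // ler_pM2l ?ltr0n //.
Qed.

(** * Young subgroups and the blocks of their partitions *)

Section FiniteYoung.
Variable n : nat.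
Implicit Types P Q : {set {set 'I_n}}.

Lemma tperm_young P B (x y : 'I_n) :
  trivIset P -> B \in P -> x \in B -> y \in B -> tperm x y \in young P.
Proof.
move=> tiP PB Bx By; rewrite inE; apply/forall_inP => C PC.
rewrite eqEcard card_imset ?leqnn ?andbT; last exact: perm_inj.
apply/subsetP => _ /imsetP[z Cz ->].
by case: tpermP => // ze; rewrite ze in Cz;
  rewrite -(def_pblock tiP PC Cz) (def_pblock tiP PB).
Qed.

(** The transposition of two common points lies in both subgroups, so it is trivial. *)
Lemma young_TI_block P Q B C (x y : 'I_n) :
    trivIset P -> trivIset Q -> (young P :&: young Q)%g = 1%g ->
    B \in P -> C \in Q -> x \in B :&: C -> y \in B :&: C -> x = y.
Proof.
move=> tiP tiQ PQ1 PB QC /setIP[Bx Cx] /setIP[By Cy].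
have : tperm x y \in (young P :&: young Q)%g.
  by rewrite inE (tperm_young tiP PB) ?(tperm_young tiQ QC).
by rewrite PQ1 => /set1P/permP/(_ x); rewrite tpermL perm1 => ->.
Qed.

(** Sending a point to its pair of blocks is injective, so the sum is part of the sum of
    [#|B| * #|C|] over all pairs, which factors as [n * n]. *)
Lemma sum_block_card_le P Q :
    partition P [set: 'I_n] -> partition Q [set: 'I_n] ->
    (young P :&: young Q)%g = 1%g ->
  (\sum_(x : 'I_n) #|pblock P x| * #|pblock Q x| <= n ^ 2)%N.
Proof.
move=> partP partQ PQ1.
have [/andP[/eqP covP /andP[tiP _]] /andP[/eqP covQ /andP[tiQ _]]] := (partP, partQ).
have inP x : x \in cover P by rewrite covP.
have inQ x : x \in cover Q by rewrite covQ.
pose h x := (pblock P x, pblock Q x).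
have inj_h : {in [set: 'I_n] &, injective h}.
  move=> x y _ _ [eP eQ].
  apply: (young_TI_block tiP tiQ PQ1 (pblock_mem (inP x)) (pblock_mem (inQ x))).
    by rewrite inE !mem_pblock inP inQ.
  by rewrite eP eQ inE !mem_pblock inP inQ.
have -> : (n ^ 2 = \sum_(z in setX P Q) #|z.1| * #|z.2|)%N.
  rewrite (eq_bigl (fun z => (z.1 \in P) && (z.2 \in Q))); last first.
    by move=> z; rewrite inE.
  rewrite -(pair_big (mem P) (mem Q) (fun B C => #|B| * #|C|)%N) /=.
  rewrite -big_distrlr /= -(card_partition partP) -(card_partition partQ).
  by rewrite cardsT card_ord mulnn.
rewrite -[leqLHS](eq_bigl _ _ (@in_setT _)) /=.
rewrite -(big_imset (fun z : {set 'I_n} * {set 'I_n} => #|z.1| * #|z.2|)%N inj_h) /=.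
rewrite [leqRHS](big_setID [set h x | x in [set: 'I_n]]) /=.
suff /setIidPr-> : [set h x | x in [set: 'I_n]] \subset setX P Q by exact: leq_addr.
by apply/subsetP => _ /imsetP[x _ ->]; rewrite inE /= !pblock_mem.
Qed.

(** An element of [young P] is determined by its restrictions to the blocks. *)
Lemma card_young_le P :
  partition P [set: 'I_n] -> (#|young P| <= \prod_(B in P) #|B|`!)%N.
Proof.
move=> /and3P[/eqP covP tiP _].
(* Families are indexed by all subsets; outside [P] the identity is the only value, which
   contributes a factor 1. *)
pose F B : {pred 'S_n} := [pred u | if B \in P then perm_on B u else u == 1%g].
pose r (s : 'S_n) := [ffun B : {set 'I_n} => if B \in P then restr_perm B s else 1%g].
have inj_r : {in young P &, injective r}.
  move=> s t; rewrite !inE => /forall_inP sP /forall_inP tP /ffunP rst.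
  apply/permP => x; have Px : x \in cover P by rewrite covP.
  have PB := pblock_mem Px; have Bx : x \in pblock P x by rewrite mem_pblock.
  have := rst (pblock P x); rewrite !ffunE PB => /permP/(_ x).
  have normB (u : 'S_n) : [forall B in P, u @: B == B] -> u \in 'N(pblock P x | 'P)%g.
    move=> /forall_inP uP; apply/astabsP => y; rewrite /= /aperm.
    by rewrite -{1}(eqP (uP _ PB)) mem_imset //; exact: perm_inj.
  by rewrite !restr_permE ?normB //; apply/forall_inP.
have -> : (\prod_(B in P) #|B|`! = #|family F|)%N.
  rewrite card_family foldrE big_image /= big_mkcond /=.
  apply: eq_bigr => B _; rewrite /F; case: ifP => _; last by rewrite card1.
  by rewrite card_perm.
rewrite -(card_in_imset inj_r); apply: subset_leq_card.
apply/subsetP => _ /imsetP[s _ ->]; apply/familyP => B; rewrite ffunE /F.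
by case: ifP => _; rewrite ?inE ?eqxx //; exact: restr_perm_on.
Qed.

End FiniteYoung.

(** * Pointwise bounds on the geometric mean of [1, ..., b] *)

Section RootFact.
Variable R : realType.

Definition root_fact (b : nat) : R := b`!%:R `^ b%:R^-1.

Lemma root_fact_ge0 b : 0 <= root_fact b.
Proof. exact: powR_ge0. Qed.

Lemma root_fact_exp b : (0 < b)%N -> root_fact b ^+ b = b`!%:R.
Proof.
move=> b0; rewrite -powR_mulrn ?root_fact_ge0 // -powRrM mulVf ?pnatr_eq0 -?lt0n //.
by rewrite powRr1 ?ler0n.
Qed.

Lemma root_fact_le b : (0 < b)%N -> root_fact b <= b%:R.
Proof.
move=> b0; rewrite -(@ler_pXn2r _ b) ?nnegrE ?root_fact_ge0 //.
rewrite root_fact_exp // -natrX ler_nat.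
elim: {b0} b => // b IHb; rewrite factS expnS leq_mul2l /= (leq_trans IHb) //.
by case: b {IHb} => // b; rewrite leq_exp2r.
Qed.

Lemma root_fact_le_half b : (6 <= b)%N -> root_fact b <= b%:R / 2%:R.
Proof.
move=> b6; have b0 : (0 < b)%N by apply: leq_trans b6.
rewrite -(@ler_pXn2r _ b) ?nnegrE ?root_fact_ge0 ?divr_ge0 //.
rewrite root_fact_exp // expr_div_n ler_pdivlMr ?exprn_gt0 // mulrC.
by rewrite -!natrX -natrM ler_nat double_fact_le.
Qed.

(** A block of size [b] contributes [b] equal factors, whose product is the factorial of [b]. *)
Lemma prod_root_fact n (P : {set {set 'I_n}}) :
  partition P [set: 'I_n] ->
  \prod_(x : 'I_n) root_fact #|pblock P x| = (\prod_(B in P) #|B|`!)%:R.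
Proof.
move=> /and3P[/eqP covP tiP P0].
rewrite -[LHS](eq_bigl _ _ (@in_setT _)) /= -covP big_trivIset // natr_prod.
apply: eq_bigr => B PB.
rewrite (eq_bigr (fun=> root_fact #|B|)) => [|x Bx]; last by rewrite (def_pblock tiP PB).
rewrite prodr_const root_fact_exp // card_gt0.
by apply: contraNneq P0 => <-.
Qed.

Lemma powR_prod (I : finType) (F : I -> R) (r : R) :
  (forall i, 0 <= F i) -> (\prod_i F i) `^ r = \prod_i F i `^ r.
Proof.
move=> F0; pose K (u v : R) := 0 <= u /\ u `^ r = v.
suff [] : K (\prod_i F i) (\prod_i F i `^ r) by [].
apply: (big_rec2 K) => [|i u v _ [v0 <-]]; first by rewrite /K powR1 ler01.
by rewrite /K mulr_ge0 // powRM.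
Qed.

Lemma le_mean_of_cube_le (p q r y : R) :
    0 <= p -> 0 <= q -> 0 <= r -> 0 <= y ->
  y ^+ 3 <= p * q * r / 64%:R -> y <= (p + q + r) / 12%:R.
Proof.
move=> p0 q0 r0 y0 yle.
rewrite -(@ler_pXn2r _ 3) ?nnegrE //; last by lra.
apply: (le_trans yle).
(* AM-GM certificate: [(p + q + r)^3 - 27 p q r] equals [3 (h1 + h2 + h3) + h4 / 2], reading each
   name as its nonnegative expression. *)
have h1 := mulr_ge0 p0 (sqr_ge0 (q - r)).
have h2 := mulr_ge0 q0 (sqr_ge0 (p - r)).
have h3 := mulr_ge0 r0 (sqr_ge0 (p - q)).
have h4 : 0 <= (p + q + r) * ((p - q) ^+ 2 + (q - r) ^+ 2 + (p - r) ^+ 2).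
  by rewrite mulr_ge0 ?addr_ge0 ?sqr_ge0.
by rewrite !exprS expr0 in h1 h2 h3 h4 *; lra.
Qed.

Lemma le_affine_of_cube_le (q y : R) :
  0 <= q -> 0 <= y -> y ^+ 3 <= 25%:R * q ^+ 2 -> y <= q / 10%:R + 1000%:R.
Proof.
move=> q0 y0 yle; rewrite -(@ler_pXn2r _ 3) ?nnegrE //; last by lra.
apply: (le_trans yle).
(* In the cube of [q/10 + 1000] the term [30 q^2] alone dominates [25 q^2]. *)
have h1 := exprn_ge0 3 q0; have h2 := sqr_ge0 q.
by rewrite !exprS expr0 in h1 h2 *; lra.
Qed.

(** The slope 1/10 lies above the 1/12 of the large-block case and below 1/9, where the gain over
    [(n/3)^n] would vanish. *)
Lemma root_fact_mean_le (b1 b2 b3 : nat) :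
    (0 < b1)%N -> (0 < b2)%N -> (0 < b3)%N ->
  (root_fact b1 * root_fact b2 * root_fact b3) `^ (2%:R / 3%:R) <=
    (b1 * b2 + b2 * b3 + b1 * b3)%:R / 10%:R + 1000%:R.
Proof.
move=> b10 b20 b30.
have [[f1 f2] f3] := (root_fact_le b10, root_fact_le b20, root_fact_le b30).
have [[g1 g2] g3] := (root_fact_ge0 b1, root_fact_ge0 b2, root_fact_ge0 b3).
have [B1 B2] : (0 : R) <= b1%:R /\ (0 : R) <= b2%:R by [].
have B3 : (0 : R) <= b3%:R by [].
have [[B12 B23] B13] := (mulr_ge0 B1 B2, mulr_ge0 B2 B3, mulr_ge0 B1 B3).
set y := _ `^ _; have y0 : 0 <= y := powR_ge0 _ _.
rewrite !natrD !natrM.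
have y3 : y ^+ 3 = (root_fact b1 * root_fact b2 * root_fact b3) ^+ 2.
  rewrite -powR_mulrn // -powRrM divfK ?pnatr_eq0 // powR_mulrn //.
  by rewrite !mulr_ge0.
(* Here [u] belongs to a block of size at most 5; the other two factors are bounded by their block
   sizes. *)
have small (u v w s t : R) : 0 <= u -> 0 <= v -> 0 <= w -> u <= 5%:R -> v <= s -> w <= t ->
    (u * v * w) ^+ 2 <= 25%:R * (s * t) ^+ 2.
  move=> u0 v0 w0 u5 vs wt.
  have -> : 25%:R = 5%:R ^+ 2 :> R by ring.
  rewrite -exprMn lerXn2r ?nnegrE ?mulr_ge0 ?(le_trans _ vs) ?(le_trans _ wt) //.
  by rewrite -mulrA !ler_pM ?mulr_ge0.
have le5 b : (0 < b)%N -> (b < 6)%N -> root_fact b <= 5%:R.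
  by move=> b0 b6; rewrite (le_trans (root_fact_le b0)) ?ler_nat.
have [b16|b16] := ltnP b1 6.
  suff : y <= b2%:R * b3%:R / 10%:R + 1000%:R by lra.
  by apply: le_affine_of_cube_le; rewrite // y3 small // le5.
have [b26|b26] := ltnP b2 6.
  suff : y <= b1%:R * b3%:R / 10%:R + 1000%:R by lra.
  by apply: le_affine_of_cube_le; rewrite // y3 [_ * root_fact b2]mulrC small // le5.
have [b36|b36] := ltnP b3 6.
  suff : y <= b1%:R * b2%:R / 10%:R + 1000%:R by lra.
  by apply: le_affine_of_cube_le; rewrite // y3 mulrC mulrA small // le5.
suff : y <= (b1%:R * b2%:R + b2%:R * b3%:R + b1%:R * b3%:R) / 12%:R by lra.
apply: le_mean_of_cube_le => //; rewrite y3.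
(* Each block size occurs in two of the three pairwise products, so their product is a square. *)
have -> : b1%:R * b2%:R * (b2%:R * b3%:R) * (b1%:R * b3%:R) / 64%:R =
    (b1%:R / 2%:R * (b2%:R / 2%:R) * (b3%:R / 2%:R)) ^+ 2 :> R by field.
rewrite lerXn2r ?nnegrE ?mulr_ge0 ?invr_ge0 //.
by rewrite !ler_pM ?mulr_ge0 ?root_fact_le_half.
Qed.

End RootFact.

(** * Averaging over the points and comparing with [n!] *)

Lemma card_young_prod_powR_le (R : realType) n (P1 P2 P3 : {set {set 'I_n}}) :
    (0 < n)%N -> partition P1 [set: 'I_n] -> partition P2 [set: 'I_n] ->
    partition P3 [set: 'I_n] -> (young P1 :&: young P2)%g = 1%g ->
    (young P2 :&: young P3)%g = 1%g -> (young P1 :&: young P3)%g = 1%g ->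
  (#|young P1| * #|young P2| * #|young P3|)%:R `^ (2%:R / 3%:R) <=
    (3%:R * n%:R / 10%:R + 1000%:R) ^+ n :> R.
Proof.
move=> n0 part1 part2 part3 P12 P23 P13.
have n0R : (0 : R) < n%:R by rewrite ltr0n.
have block_gt0 P x : partition P [set: 'I_n] -> (0 < #|pblock P x|)%N.
  move=> /andP[/eqP covP _]; apply/card_gt0P; exists x.
  by rewrite mem_pblock covP.
pose a (P : {set {set 'I_n}}) x : R := root_fact R #|pblock P x|.
pose y x := (a P1 x * a P2 x * a P3 x) `^ (2%:R / 3%:R).
have a0 P x : 0 <= a P x by exact: root_fact_ge0.
have le_prod : (#|young P1| * #|young P2| * #|young P3|)%:R <=
    \prod_x (a P1 x * a P2 x * a P3 x).
  rewrite !big_split /= !prod_root_fact // -!natrM ler_nat.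
  by rewrite !leq_mul ?card_young_le.
have r0 : (0 : R) <= 2%:R / 3%:R by rewrite divr_ge0.
apply: (le_trans (ge0_ler_powR r0 _ _ le_prod)).
- by rewrite nnegrE.
- by rewrite nnegrE prodr_ge0 // => x _; rewrite !mulr_ge0.
rewrite powR_prod => [|x]; last by rewrite !mulr_ge0.
have y0 x : 0 <= y x by exact: powR_ge0.
(* AM-GM over the [n] points leaves only the mean of [y] to bound. *)
have := (@leif_AGM R 'I_n predT y (fun x _ => y0 x)).1.
rewrite card_ord => /le_trans; apply; apply: lerXn2r; rewrite ?nnegrE.
- by rewrite divr_ge0 ?sumr_ge0.
- by rewrite addr_ge0 ?divr_ge0 ?mulr_ge0.
rewrite ler_pdivrMr //.
pose w x := (#|pblock P1 x| * #|pblock P2 x| + #|pblock P2 x| * #|pblock P3 x| +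
  #|pblock P1 x| * #|pblock P3 x|)%N.
have sum_w : (\sum_x w x <= 3 * n ^ 2)%N.
  rewrite !big_split /= !mulSn mul0n addn0 addnA.
  by rewrite !leq_add ?sum_block_card_le.
apply: (@le_trans _ _ (\sum_(x : 'I_n) ((w x)%:R / 10%:R + 1000%:R))).
  by apply: ler_sum => x _; rewrite root_fact_mean_le ?block_gt0.
rewrite big_split /= sumr_const card_ord -mulr_suml -natr_sum -mulr_natr.
rewrite -(ler_nat R) natrM natrX expr2 in sum_w; nra.
Qed.

(** Since [1 + t <= exp t] with [t = b / (a n)], the additive constant costs a factor independent of
    [n]. *)
Lemma affine_expn_le (R : realType) (n : nat) (a b : R) :
  (0 < n)%N -> 0 < a -> 0 <= b ->
  (a * n%:R + b) ^+ n <= (a * n%:R) ^+ n * expR (b / a).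
Proof.
move=> n0 a0 b0; have n0R : (0 : R) < n%:R by rewrite ltr0n.
have -> : b / a = n%:R * (b / (a * n%:R)).
  by field; rewrite !lt0r_neq0.
have an0 : 0 < a * n%:R by rewrite mulr_gt0.
rewrite expRM_natl -exprMn lerXn2r ?nnegrE ?addr_ge0 ?mulr_ge0 ?expR_ge0 ?(ltW a0) //.
have -> : a * n%:R + b = a * n%:R * (1 + b / (a * n%:R)).
  by field; rewrite !lt0r_neq0.
by rewrite ler_pM2l // expR_ge1Dx.
Qed.

Theorem theorem4p2 (R : realType) :
  exists c d : R, [/\ 0 < c, 0 < d &
    forall (n : nat), (2 <= n)%N ->
    forall (H1 H2 H3 : {group 'S_n}),
      is_young_subgroup H1 -> is_young_subgroup H2 -> is_young_subgroup H3 ->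
      (H1 :&: H2)%g = 1%g -> (H2 :&: H3)%g = 1%g -> (H1 :&: H3)%g = 1%g ->
      #|[set: 'S_n]|%:R / ((#|H1| * #|H2| * #|H3|)%N%:R `^ (2%:R / 3%:R))
        >= expR (c * n%:R - d * Num.sqrt n%:R * ln n%:R)].
Proof.
(* 10/9 is the ratio of [n/3] to [3n/10]. The loss is a constant [exp D]; dividing [D] by [ln 2]
   makes the error term at least [D] for all [n >= 2]. *)
exists (ln (10%:R / 9%:R)), (1000%:R / (3%:R / 10%:R) / ln 2%:R).
have ln2 : 0 < ln 2%:R :> R by rewrite ln_gt0 ?ltr1n.
split; [by rewrite ln_gt0 //; lra | by rewrite divr_gt0 //; lra |].
move=> n n2 H1 H2 H3 [P1 part1 ->] [P2 part2 ->] [P3 part3 ->] P12 P23 P13.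
have n0 : (0 < n)%N by apply: leq_trans n2.
have n0R : (0 : R) < n%:R by rewrite ltr0n.
have n2R : (2%:R : R) <= n%:R by rewrite ler_nat.
set X : R := _ `^ _.
have X0 : 0 < X by rewrite powR_gt0 // ltr0n !muln_gt0 !cardG_gt0.
set D : R := 1000%:R / (3%:R / 10%:R).
have X_le : X <= (3%:R / 10%:R * n%:R) ^+ n * expR D.
  apply: le_trans (card_young_prod_powR_le R n0 part1 part2 part3 P12 P23 P13) _.
  rewrite mulrAC; apply: affine_expn_le => //; lra.
have d_ge : D <= D / ln 2%:R * Num.sqrt n%:R * ln n%:R.
  have D0 : 0 < D by rewrite /D; lra.
  rewrite -2!mulrA ler_peMr ?(ltW D0) // mulrC ler_pdivlMr // mul1r.
  have sqrt_ge1 : 1 <= Num.sqrt n%:R :> R.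
    by rewrite -[leLHS]sqrtr1 ler_wsqrtr // ler1n.
  have ln_ge : ln 2%:R <= ln n%:R :> R by rewrite ler_ln ?posrE.
  by rewrite (le_trans ln_ge) // ler_peMl // (le_trans (ltW ln2)).
rewrite ler_pdivlMr //.
rewrite cardsT card_Sn; apply: le_trans _ (expn_le_fact R n).
(* The factors [exp D] cancel, and [(10/9)^n (3n/10)^n] is exactly [(n/3)^n]. *)
apply: (@le_trans _ _ (expR (ln (10%:R / 9%:R) * n%:R - D) *
    ((3%:R / 10%:R * n%:R) ^+ n * expR D))).
  by rewrite ler_pM ?expR_ge0 ?(ltW X0) // ler_expR; lra.
rewrite mulrCA -expRD subrK mulrC (mulrC (ln _)) expRM_natl lnK ?posrE; last by lra.
by rewrite -exprMn le_eqVlt; apply/orP; left; apply/eqP; congr (_ ^+ _); field.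
Qed.
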